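(* Let $\phi^k,\phi^{k-1}\in\mathcal{G}_N$ with $\overline{\phi^k}=\overline{\phi^{k-1}}$. Then each of the following two equations has a unique solution $\phi^{k+1}\in\mathcal{G}_N$ (the two solutions being in general different): \[ \frac{\frac32\phi^{k+1}-2\phi^k+\frac12\phi^{k-1}}{\Delta t}=\Delta_N\mu_i^{k+1},\quad i=1,2, \] where \[ \mu_1^{k+1}=-\nabla_N\cdot(|\nabla_N\phi^{k+1}|^2\nabla_N\phi^{k+1})+a\phi^{k+1}+2\Delta_N(2\phi^k-\phi^{k-1})-A\Delta t\,\Delta_N(\phi^{k+1}-\phi^k)+\Delta_N^2\phi^{k+1}, \] \[ \mu_2^{k+1}=-\nabla_N\cdot(|\nabla_N\phi^{k+1}|^2\nabla_N\phi^{k+1})-\varepsilon(2\phi^k-\phi^{k-1})-A\Delta t\,\Delta_N(\phi^{k+1}-\phi^k)+(1+\Delta_N)^2\phi^{k+1}. \] Moreover the schemes are mass conservative: if a sequence $(\phi^k)_{k\ge -1}$ is generated by either scheme from data with $\overline{\phi^0}=\overline{\phi^{-1}}=:\beta_0$, then $\overline{\phi^k}=\beta_0$ for all $k\ge0$.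
   Context: Let $K\in\mathbb{N}$, $N=2K+1$, $h=1/N$, $\Omega=(0,1)^3$, grid points $(ih,jh,kh)$. $\mathcal{G}_N$ is the space of real grid functions on $\mathbb{Z}^3$ that are $N$-periodic in each index; $\langle f,g\rangle=h^3\sum_{i,j,k=0}^{N-1}f_{i,j,k}g_{i,j,k}$ and $\overline f=\langle f,1\rangle$. Each $f\in\mathcal{G}_N$ has discrete Fourier expansion $f_{i,j,k}=\sum_{\ell,m,n=-K}^K\hat f_{\ell,m,n}\exp(2\pi\mathrm{i}(\ell x_i+my_j+nz_k))$; $\mathcal{D}_x$ multiplies coefficients by $2\pi\mathrm{i}\ell$ (similarly $\mathcal{D}_y,\mathcal{D}_z$ with $m,n$), $\nabla_Nf=(\mathcal{D}_xf,\mathcal{D}_yf,\mathcal{D}_zf)$, $\nabla_N\cdot(f_1,f_2,f_3)=\mathcal{D}_xf_1+\mathcal{D}_yf_2+\mathcal{D}_zf_3$, $\Delta_N$ multiplies coefficients by $-4\pi^2(\ell^2+m^2+n^2)$; products such as $|\nabla_N\phi|^2\nabla_N\phi$ are taken pointwise. Parameters: $\Delta t>0$ is the time step, $0<\varepsilon<1$, $a:=1-\varepsilon>0$, and $A\ge0$ is a constant (artificial diffusion coefficient). *)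

(* Defs.v *)
From HB Require Import structures.
From mathcomp Require Import all_boot all_order all_algebra.
From mathcomp Require Import complex.
From mathcomp Require Import reals trigo.
Set Implicit Arguments. Unset Strict Implicit. Unset Printing Implicit Defensive.
Import Order.TTheory GRing.Theory Num.Theory.
Local Open Scope ring_scope.
Local Open Scope complex_scope.

(* N = 2K+1 ; grid indices 0..N-1 are the elements of 'I_(2K+1).
   An N-periodic grid function on Z^3 is identified with its values on
   {0..N-1}^3. *)
Definition NN (K : nat) : nat := (2 * K + 1)%N.

Definition grid (R : Type) (K : nat) := 'I_(NN K) -> 'I_(NN K) -> 'I_(NN K) -> R.

Section Grid.
Variables (R : realType) (K : nat).

Definition hh : R := 1 / (NN K)%:R.

Definition coord (i : 'I_(NN K)) : R := (i : nat)%:R * hh.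

(* frequency index: q : 'I_N  <->  q - K in {-K, ..., K} *)
Definition freq (q : 'I_(NN K)) : int := (q : nat)%:Z - K%:Z.

Definition expi (t : R) : R[i] := Complex (cos t) (sin t).

Definition ip (f g : grid R K) : R :=
  hh ^+ 3 * \sum_(i < NN K) \sum_(j < NN K) \sum_(k < NN K) f i j k * g i j k.
Definition mean (f : grid R K) : R := ip f (fun _ _ _ => 1).

Definition mode (l m n : 'I_(NN K)) (i j k : 'I_(NN K)) : R[i] :=
  expi (2 * pi * ((freq l)%:~R * coord i + (freq m)%:~R * coord j
                  + (freq n)%:~R * coord k)).

(* discrete Fourier coefficients: the unique coefficients of the expansion
   f_{ijk} = sum_{l,m,n=-K}^K fhat_{lmn} exp(2 pi i (l x_i + m y_j + n z_k)) *)
Definition fhat (f : grid R K) (l m n : 'I_(NN K)) : R[i] :=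
  (hh ^+ 3)%:C * \sum_(i < NN K) \sum_(j < NN K) \sum_(k < NN K)
      (f i j k)%:C * (mode l m n i j k)^*.

(* spectral operator multiplying the coefficient of mode (l,m,n) by
   sym (l,m,n); for the symbols used below the result is real, and we take
   the real part to land in G_N. *)
Definition specop (sym : int -> int -> int -> R[i]) (f : grid R K) : grid R K :=
  fun i j k => complex.Re (\sum_(l < NN K) \sum_(m < NN K) \sum_(n < NN K)
        sym (freq l) (freq m) (freq n) * fhat f l m n * mode l m n i j k).

Definition Dx : grid R K -> grid R K :=
  specop (fun l _ _ => (2 * pi * l%:~R)%:C * 'i).
Definition Dy : grid R K -> grid R K :=
  specop (fun _ m _ => (2 * pi * m%:~R)%:C * 'i).
Definition Dz : grid R K -> grid R K :=
  specop (fun _ _ n => (2 * pi * n%:~R)%:C * 'i).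
Definition lapN : grid R K -> grid R K :=
  specop (fun l m n => (- 4 * pi ^+ 2 * (l%:~R ^+ 2 + m%:~R ^+ 2 + n%:~R ^+ 2))%:C).

Definition divN (f1 f2 f3 : grid R K) : grid R K :=
  fun i j k => Dx f1 i j k + Dy f2 i j k + Dz f3 i j k.

Definition pLap (phi : grid R K) : grid R K :=
  let g := fun i j k => Dx phi i j k ^+ 2 + Dy phi i j k ^+ 2 + Dz phi i j k ^+ 2 in
  divN (fun i j k => g i j k * Dx phi i j k)
       (fun i j k => g i j k * Dy phi i j k)
       (fun i j k => g i j k * Dz phi i j k).

Definition oneplap (f : grid R K) : grid R K := fun i j k => f i j k + lapN f i j k.

(* chemical potentials; phi1 = phi^{k+1}, phi0 = phi^k, phim = phi^{k-1} *)
Definition mu1 (dt eps A : R) (phim phi0 phi1 : grid R K) : grid R K :=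
  fun i j k =>
    - pLap phi1 i j k + (1 - eps) * phi1 i j k
    + 2 * lapN (fun i j k => 2 * phi0 i j k - phim i j k) i j k
    - A * dt * lapN (fun i j k => phi1 i j k - phi0 i j k) i j k
    + lapN (lapN phi1) i j k.

Definition mu2 (dt eps A : R) (phim phi0 phi1 : grid R K) : grid R K :=
  fun i j k =>
    - pLap phi1 i j k - eps * (2 * phi0 i j k - phim i j k)
    - A * dt * lapN (fun i j k => phi1 i j k - phi0 i j k) i j k
    + oneplap (oneplap phi1) i j k.

Definition scheme
    (mu : R -> R -> R -> grid R K -> grid R K -> grid R K -> grid R K)
    (dt eps A : R) (phim phi0 phi1 : grid R K) : Prop :=
  forall i j k,
    (3 / 2 * phi1 i j k - 2 * phi0 i j k + 1 / 2 * phim i j k) / dt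
    = lapN (mu dt eps A phim phi0 phi1) i j k.

End Grid.

(* Main.v *)
Require Import Defs.
From HB Require Import structures.
From mathcomp Require Import all_boot all_order all_algebra.
From mathcomp Require Import complex.
From mathcomp Require Import reals trigo.
From mathcomp Require Import boolp classical_sets topology normedtype derive.
From mathcomp Require Import ring lra zify.
Set Implicit Arguments. Unset Strict Implicit. Unset Printing Implicit Defensive.
Import Order.TTheory GRing.Theory Num.Theory numFieldNormedType.Exports.
Local Open Scope ring_scope.

(* Both schemes have the form c (p - r) = L mu(p), where c = 3 / (2 dt),
   r = (4 phi^k - phi^(k-1)) / 3, L is the discrete Laplacian and mu is the
   gradient of a convex energy E: the 4-Laplacian part because the D's are
   skew-adjoint, the linear part because it is symmetric positive semidefinite.
   Orthogonality of the discrete Fourier modes gives the spectral gap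
   -<L w, w> >= 4 pi^2 |w - mean w|^2 and that L w has zero mean.  Monotonicity of
   mu yields uniqueness.  For existence put p = r + L w: then w only has to be a
   critical point of c/2 <w, -L w> + E(r + L w), which is convex, and coercive once
   a multiple of (sum w)^2 is added; minimisers exist by compactness.  Summing a
   scheme over the grid kills the right-hand side, whence mass conservation. *)

(** * Inner products and kernel operators on a finite index set *)

Section Dot.
Variables (R : realType) (T : finType).
Implicit Types (u v w : T -> R) (G H : T -> T -> R).

Definition dot u v : R := \sum_x u x * v x.
(** Operators are given by kernels, so that being self-adjoint or skew-adjoint is a pointwise
    identity of [G]. *)
Definition kop G u : T -> R := fun x => \sum_y G x y * u y.

Lemma dotC u v : dot u v = dot v u.
Proof. by apply: eq_bigr => x _; rewrite mulrC. Qed.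

Lemma dotDl a u b v w :
  dot (fun x => a * u x + b * v x) w = a * dot u w + b * dot v w.
Proof.
rewrite /dot !mulr_sumr -big_split; apply: eq_bigr => x _ /=; ring.
Qed.

Lemma dot_ge0 u : 0 <= dot u u.
Proof. by apply: sumr_ge0 => x _; rewrite -expr2 sqr_ge0. Qed.

Lemma dot_eq0 u : dot u u <= 0 -> forall x, u x = 0.
Proof.
move=> le0 x; have /eqP : dot u u = 0 by apply/eqP; rewrite eq_le le0 dot_ge0.
rewrite psumr_eq0 => [/allP/(_ x)|y _]; last by rewrite -expr2 sqr_ge0.
by rewrite mem_index_enum mulf_eq0 orbb => /(_ isT)/eqP.
Qed.

Lemma kopD G a u b v x :
  kop G (fun y => a * u y + b * v y) x = a * kop G u x + b * kop G v x.
Proof.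
rewrite /kop !mulr_sumr -big_split; apply: eq_bigr => y _ /=; ring.
Qed.

Lemma kop_comp G H u x :
  kop (fun x z => \sum_y G x y * H y z) u x = kop G (kop H u) x.
Proof.
rewrite /kop; under [RHS]eq_bigr do rewrite mulr_sumr.
rewrite [RHS]exchange_big; apply: eq_bigr => z _ /=.
by rewrite mulr_suml; apply: eq_bigr => y _; rewrite mulrA.
Qed.

Lemma dot_kopE G u v : dot (kop G u) v = \sum_x \sum_y G x y * u y * v x.
Proof. by apply: eq_bigr => x _; rewrite mulr_suml. Qed.

Lemma dot_kop_sym G u v : (forall x y, G x y = G y x) ->
  dot (kop G u) v = dot u (kop G v).
Proof.
move=> Gs; rewrite (dotC u) !dot_kopE exchange_big.
by apply: eq_bigr => x _; apply: eq_bigr => y _; rewrite Gs; ring.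
Qed.

Lemma dot_kop_skew G u v : (forall x y, G x y = - G y x) ->
  dot (kop G u) v = - dot u (kop G v).
Proof.
move=> Gs; rewrite (dotC u) !dot_kopE exchange_big -sumrN.
apply: eq_bigr => x _; rewrite -sumrN; apply: eq_bigr => y _.
by rewrite Gs; ring.
Qed.

Lemma dotDr a u b v w :
  dot w (fun x => a * u x + b * v x) = a * dot w u + b * dot w v.
Proof. by rewrite dotC dotDl !(dotC w). Qed.

Lemma eq_dot u u' v v' :
  u =1 u' -> v =1 v' -> dot u v = dot u' v'.
Proof. by move=> uu vv; apply: eq_bigr => x _; rewrite uu vv. Qed.

Lemma kop_ext G u v x :
  u =1 v -> kop G u x = kop G v x.
Proof. by move=> uv; apply: eq_bigr => y _; rewrite uv. Qed.

Lemma dot_cst a u :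
  dot u (fun=> a) = a * \sum_x u x.
Proof. by rewrite /dot mulr_sumr; apply: eq_bigr => x _; rewrite mulrC. Qed.

(** The tangent inequality of a convex quadratic form: expand the form at [u - v], where symmetry
    merges the two cross terms. *)
Lemma quad_convex G u v :
  (forall x y, G x y = G y x) -> (forall w, 0 <= dot (kop G w) w) ->
  dot (kop G v) v / 2 + dot (kop G v) (fun x => u x - v x) <= dot (kop G u) u / 2.
Proof.
move=> Gs Gp; pose d x := 1 * u x + (-1) * v x.
have := Gp d.
have -> : dot (kop G d) d = dot (kop G u) u - 2 * dot (kop G v) u + dot (kop G v) v.
  rewrite (eq_dot (u' := fun x => 1 * kop G u x + (-1) * kop G v x) (v' := d))//; last first.
    by move=> x; rewrite kopD.
  rewrite dotDl !dotDr (dot_kop_sym u v Gs) (dotC u (kop G v)); ring.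
have -> : dot (kop G v) (fun x => u x - v x) = dot (kop G v) u - dot (kop G v) v.
  rewrite (eq_dot (u' := kop G v) (v' := d)) ?dotDr//; first ring.
  by move=> x; rewrite /d; ring.
lra.
Qed.

Lemma kopB G u v x : kop G (fun y => u y - v y) x = kop G u x - kop G v x.
Proof. by rewrite /kop -sumrB; apply: eq_bigr => y _; rewrite mulrBr. Qed.

End Dot.

(** * Critical points of convex coercive functionals *)

Section Critical.
Local Open Scope classical_set_scope.
Variables (R : realType) (T : finType).
Local Notation V := (prod_topology (fun _ : T => R)).

Lemma continuous_addr (X : topologicalType) (f g : X -> R) :
  continuous f -> continuous g -> continuous (fun x => f x + g x).
Proof. by move=> cf cg x; apply: continuousD; [exact: cf|exact: cg]. Qed.

Lemma continuous_oppr (X : topologicalType) (f : X -> R) :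
  continuous f -> continuous (fun x => - f x).
Proof. by move=> cf x; apply: continuousN; exact: cf. Qed.

Lemma continuous_mulr (X : topologicalType) (f g : X -> R) :
  continuous f -> continuous g -> continuous (fun x => f x * g x).
Proof. by move=> cf cg x; apply: continuousM; [exact: cf|exact: cg]. Qed.

Lemma continuous_sumr (X : topologicalType) (I : finType) (F : I -> X -> R) :
  (forall i, continuous (F i)) -> continuous (fun x => \sum_i F i x).
Proof.
move=> cF; elim: (index_enum I) => [|i s ih] x.
  by under eq_fun do rewrite big_nil; exact: cvg_cst.
under eq_fun do rewrite big_cons.
exact: continuous_addr.
Qed.

Lemma continuous_kop (X : topologicalType) (G : T -> T -> R) (f : X -> T -> R) y :
  (forall x, continuous (fun w => f w x)) -> continuous (fun w => kop G (f w) y).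
Proof.
move=> cf; apply: continuous_sumr => x; apply: continuous_mulr => //.
by move=> w; exact: cvg_cst.
Qed.

Lemma continuous_dot (X : topologicalType) (f g : X -> T -> R) :
  (forall x, continuous (fun w => f w x)) ->
  (forall x, continuous (fun w => g w x)) ->
  continuous (fun w => dot (f w) (g w)).
Proof.
move=> cf cg; apply: continuous_sumr => x w.
by apply: continuousM; [exact: cf|exact: cg].
Qed.

Lemma continuous_to_prod (X : topologicalType) (f : X -> V) :
  (forall x, continuous (fun w => f w x)) -> continuous f.
Proof.
move=> cf w; apply/cvg_sup => x.
exact: (@continuous_comp_initial V X R (fun v => v x) f (cf x) w).
Qed.

Lemma continuous_coord (x : T) : continuous (fun w : V => w x).
Proof. exact: (@proj_continuous T (fun=> R) x). Qed.

Lemma coercive_min (J : V -> R) (k C : R) :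
  0 < k -> (forall w, k * dot w w - C <= J w) -> continuous J ->
  exists w, forall u, J w <= J u.
Proof.
(* The box radius [m] is such that one coordinate beyond [m] forces [dot u u >= m - 1] (as
   [m >= 1]), hence [J u >= J 0]; the minimum over the box, compact by Tychonoff, is then global. *)
move=> k0 Jc cJ; pose m := (J (fun=> 0) + C) / k + 1.
have Jm : J (fun=> 0) + C <= k * (m - 1) by rewrite /m addrK mulrC divfK ?gt_eqF.
have m1 : 1 <= m.
  have := Jc (fun=> 0); rewrite /dot big1 ?mulr0 ?sub0r => [h|i _]; last by [].
  by rewrite /m lerDr divr_ge0 ?(ltW k0)//; lra.
pose B : set V := [set w | forall x, [set` `[-m, m]%R] (w x)].
have [|||w wB wmin] := @compact_EVT_min V R J B.
- exists (fun=> 0) => x /=; rewrite in_itv/=; apply/andP; split; lra.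
- have := @tychonoff T (fun=> R) (fun=> [set` `[-m, m]%R]) (fun=> @segment_compact R (-m) m).
  exact.
- by apply: continuous_subspaceT.
exists w => u; case: (pselect (B u)) => [uB|nB]; first by apply: wmin; rewrite inE.
have w0 : J w <= J (fun=> 0).
  by apply: wmin; rewrite inE => x /=; rewrite in_itv/=; apply/andP; split; lra.
apply: le_trans w0 _.
have [x xm] : exists x, m < `|u x|.
  apply: contrapT => h; apply: nB => x /=; rewrite in_itv/= -ler_norml leNgt.
  by apply/negP => hx; apply: h; exists x.
apply: le_trans (Jc u); rewrite lerBrDr; apply: le_trans Jm _.
rewrite ler_pM2l//.
have : `|u x| ^+ 2 <= dot u u.
  rewrite real_normK ?num_real// /dot (bigD1 x)//= expr2 lerDl.
  by apply: sumr_ge0 => y _; rewrite -expr2 sqr_ge0.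
nra.
Qed.

(* Convexity at [w - t DJ w] together with
   minimality at [w] gives [<DJ (w - t DJ w), DJ w> <= 0] for [t > 0]; let [t] tend
   to [0]. *)
Lemma convex_coercive_critical (J : V -> R) (DJ : V -> T -> R) (k C : R) :
  0 < k -> (forall w, k * dot w w - C <= J w) -> continuous J ->
  (forall x, continuous (fun w => DJ w x)) ->
  (forall w u, J w + dot (DJ w) (fun x => u x - w x) <= J u) ->
  exists w, forall x, DJ w x = 0.
Proof.
move=> k0 Jc cJ cDJ Jconv; have [w wmin] := coercive_min k0 Jc cJ.
exists w; apply: dot_eq0.
pose p (t : R) : V := fun x => w x - t * DJ w x.
pose F t := dot (DJ (p t)) (DJ w).
have F0 : F 0 = dot (DJ w) (DJ w).
  by rewrite /F (_ : p 0 = w)//; apply/funext => x; rewrite /p mul0r subr0.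
have cp : continuous p.
  apply: continuous_to_prod => x t.
  apply: (@continuousB _ _ _ (fun=> w x) (fun s : R => s * DJ w x)).
    exact: cvg_cst.
  by apply: (@continuousM _ _ (fun s : R => s) (fun=> DJ w x)); [exact: cvg_id|exact: cvg_cst].
have cF : continuous F.
  apply: continuous_dot => x t; last exact: cvg_cst.
  by apply: (@continuous_comp _ _ _ p (fun w => DJ w x)); [exact: cp|exact: cDJ].
rewrite -F0; have Fr : F t @[t --> (0:R)^'+] --> F 0.
  by apply: cvg_at_right_filter; exact: cF.
rewrite -(cvg_lim _ Fr)//; apply: limr_le; first by apply/cvg_ex; exists (F 0).
near=> t; have t0 : 0 < t by near: t; exact: nbhs_right_gt.
have := Jconv (p t) w; have := wmin (p t).
have -> : dot (DJ (p t)) (fun x => w x - p t x) = t * F t.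
  by rewrite /F /dot mulr_sumr; apply: eq_bigr => x _; rewrite /p; ring.
move=> h1 h2; have : t * F t <= 0 by lra.
by rewrite pmulr_rle0.
Unshelve. all: by end_near.
Qed.

End Critical.

(** * The abstract flow equation: energy, uniqueness, existence *)

Section PLaplace.
Variables (R : realType) (T : finType) (G1 G2 G3 B L : T -> T -> R).
Variables (b r : T -> R) (c k g : R).
Hypothesis G1skew : forall x y, G1 x y = - G1 y x.
Hypothesis G2skew : forall x y, G2 x y = - G2 y x.
Hypothesis G3skew : forall x y, G3 x y = - G3 y x.
Hypothesis Bsym : forall x y, B x y = B y x.
Hypothesis Bpsd : forall w, 0 <= dot (kop B w) w.
Hypothesis Lsym : forall x y, L x y = L y x.
Hypothesis Lsum0 : forall w, \sum_x kop L w x = 0.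
Hypothesis c0 : 0 < c.
Hypothesis k0 : 0 < k.
Hypothesis g0 : 0 < g.
(** On functions of zero sum this is a spectral gap; the last term makes up for the constants, which
    [L] annihilates. *)
Hypothesis Lcoer :
  forall w, k * dot w w <= - dot (kop L w) w + g * (\sum_x w x) ^+ 2.

Definition sqgrad (p : T -> R) x := kop G1 p x ^+ 2 + kop G2 p x ^+ 2 + kop G3 p x ^+ 2.

Definition plaplace (p : T -> R) x :=
  kop G1 (fun y => sqgrad p y * kop G1 p y) x
  + kop G2 (fun y => sqgrad p y * kop G2 p y) x
  + kop G3 (fun y => sqgrad p y * kop G3 p y) x.

(** [B] holds the linear terms in the new time level, [b] the terms known from the two earlier
    levels. *)
Definition potential (p : T -> R) x := - plaplace p x + kop B p x + b x.

Definition energy (p : T -> R) :=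
  (\sum_x sqgrad p x ^+ 2) / 4 + dot (kop B p) p / 2 + dot b p.

(** Summation by parts: moving each skew kernel onto [v] costs a sign, which cancels the one in
    front of [plaplace]. *)
Lemma dot_potential p v : dot (potential p) v =
  \sum_x sqgrad p x * (kop G1 p x * kop G1 v x + kop G2 p x * kop G2 v x
                       + kop G3 p x * kop G3 v x) + dot (kop B p) v + dot b v.
Proof.
have dotD u1 u2 : dot (fun x => u1 x + u2 x) v = dot u1 v + dot u2 v.
  by rewrite /dot -big_split; apply: eq_bigr => x _ /=; rewrite mulrDl.
rewrite !dotD; congr (_ + _ + _).
have -> : dot (fun x => - plaplace p x) v = - dot (plaplace p) v.
  by rewrite /dot -sumrN; apply: eq_bigr => x _; rewrite mulNr.
rewrite !dotD !dot_kop_skew// -!opprD opprK /dot -!big_split.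
by apply: eq_bigr => x _ /=; ring.
Qed.

(* |q|^4 - |p|^4 - 4 |p|^2 p.(q - p) = (|q|^2 - |p|^2)^2 + 2 |p|^2 |q - p|^2 *)
Lemma energy_convex p q :
  energy p + dot (potential p) (fun x => q x - p x) <= energy q.
Proof.
rewrite dot_potential /energy.
have := quad_convex q p Bsym Bpsd.
have -> : dot b (fun x => q x - p x) = dot b q - dot b p.
  by rewrite /dot -sumrB; apply: eq_bigr => x _; ring.
set S := \sum_x _ * _.
suff : (\sum_x sqgrad p x ^+ 2) / 4 + S <= (\sum_x sqgrad q x ^+ 2) / 4 by lra.
rewrite /S !mulr_suml -big_split; apply: ler_sum => x _ /=.
rewrite !kopB.
have : 0 <= (sqgrad q x - sqgrad p x) ^+ 2
  + 2 * sqgrad p x * ((kop G1 q x - kop G1 p x) ^+ 2 + (kop G2 q x - kop G2 p x) ^+ 2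
                      + (kop G3 q x - kop G3 p x) ^+ 2).
  apply: addr_ge0; first exact: sqr_ge0.
  by rewrite !mulr_ge0// /sqgrad ?addr_ge0// sqr_ge0.
rewrite /sqgrad; lra.
Qed.

(** Sum of the tangent inequalities of the energy at [p] and at [q]. *)
Lemma potential_monotone p q :
  0 <= dot (fun x => potential q x - potential p x) (fun x => q x - p x).
Proof.
have := energy_convex p q; have := energy_convex q p.
have -> : dot (fun x => potential q x - potential p x) (fun x => q x - p x) =
  - dot (potential q) (fun x => p x - q x) - dot (potential p) (fun x => q x - p x).
  by rewrite /dot -sumrN -sumrB; apply: eq_bigr => x _; ring.
lra.
Qed.

(** By symmetry [|L a|^2 = <a, L (L a)>], a multiple of the sum of a function in the range of
    [L]. *)
Lemma kop_cst0 a x : kop L (fun=> a) x = 0.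
Proof.
move: x; apply: dot_eq0.
by rewrite (dot_kop_sym _ _ Lsym) dotC dot_cst Lsum0 mulr0.
Qed.

(* With m the difference of the potentials, <L m, m> = c <q - p, m> >= 0, and L is
   negative definite off the constants: m is constant and c (q - p) = L m = 0. *)
Lemma flow_unique p q :
  (forall x, c * (p x - r x) = kop L (potential p) x) ->
  (forall x, c * (q x - r x) = kop L (potential q) x) -> p =1 q.
Proof.
move=> hp hq x0.
pose m x := potential q x - potential p x.
have opm x : kop L m x = c * (q x - p x).
  rewrite (kop_ext L (v := fun x => 1 * potential q x + (-1) * potential p x)).
    by rewrite kopD -hp -hq; ring.
  by move=> y; rewrite /m; ring.
have mL : 0 <= dot (kop L m) m.
  rewrite (eq_dot (u' := fun x => c * (q x - p x)) (v' := m))//.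
  have -> : dot (fun x => c * (q x - p x)) m = c * dot m (fun x => q x - p x).
    by rewrite /dot mulr_sumr; apply: eq_bigr => x _; ring.
  by rewrite mulr_ge0 ?(ltW c0) ?potential_monotone.
(* Subtracting the mean [e] makes the sum term of [Lcoer] vanish without changing [L m]. *)
pose e := (\sum_x m x) / #|T|%:R.
pose m' x := 1 * m x + 1 * - e.
have n0 : #|T|%:R != 0 :> R by rewrite pnatr_eq0 -lt0n; apply/card_gt0P; exists x0.
have sm' : \sum_x m' x = 0.
  rewrite big_split /= sumr_const mul1r -mulr_natr mulNr /e divfK//.
  by under eq_bigr do rewrite mul1r; rewrite subrr.
have opm' x : kop L m' x = kop L m x by rewrite kopD kop_cst0; ring.
have m'0 : forall x, m' x = 0.
  apply: dot_eq0; rewrite -(pmulr_rle0 _ k0); apply: le_trans (Lcoer _) _.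
  rewrite sm' expr0n mulr0 addr0 (eq_dot (v' := m') opm')//.
  by rewrite dotDr (dot_cst (- e)) Lsum0; lra.
have : c * (q x0 - p x0) = 0.
  by rewrite -opm -opm' /kop big1// => y _; rewrite m'0 mulr0.
by move/eqP; rewrite mulf_eq0 gt_eqF//= subr_eq0 => /eqP.
Qed.

(* Writing p = r + L w turns the equation into L (c w - mu (r + L w)) = 0, the
   Euler-Lagrange equation of a convex functional of w.  The rank-one term in
   [P] restores coercivity along the constants, which L annihilates. *)
Lemma flow_exists :
  exists p, forall x, c * (p x - r x) = kop L (potential p) x.
Proof.
pose P x y := - L x y + g.
have opP w x : kop P w x = - kop L w x + g * \sum_y w y.
  by rewrite /kop mulr_sumr -sumrN -big_split; apply: eq_bigr => y _ /=; rewrite /P; ring.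
have Psym x y : P x y = P y x by rewrite /P Lsym.
have PP w : k * dot w w <= dot (kop P w) w.
  apply: le_trans (Lcoer w) _.
  rewrite (eq_dot (u := kop P w) (u' := fun x => (-1) * kop L w x + 1 * (g * \sum_y w y)) (v' := w))//.
    by rewrite dotDl (dotC (fun=> g * \sum_y w y)) dot_cst; lra.
  by move=> x; rewrite opP; ring.
have Ppsd w : 0 <= dot (kop P w) w.
  by apply: le_trans (PP w); rewrite mulr_ge0 ?(ltW k0) ?dot_ge0.
pose s (w : T -> R) x := r x + kop L w x.
pose J w := c * (dot (kop P w) w / 2) + energy (s w).
(* The gradient of [J]: the chain rule through the affine map [s] brings in the transpose of [L],
   which is [L]. *)
pose DJ w x := c * kop P w x + kop L (potential (s w)) x.
have [w Dw] : exists w, forall x, DJ w x = 0.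
  pose Lb := kop L b.
  have ccst (a : R) : continuous (fun _ : prod_topology (fun _ : T => R) => a).
    exact: cst_continuous.
  have cw x : continuous ((fun w => w x) : prod_topology (fun _ : T => R) -> R).
    exact: continuous_coord.
  have cs x : continuous (s^~ x : prod_topology (fun _ : T => R) -> R).
    by apply: continuous_addr => //; apply: continuous_kop; exact: continuous_coord.
  have csq x : continuous ((fun w => sqgrad (s w) x) : prod_topology (fun _ : T => R) -> R).
    by do ?apply: continuous_addr; apply: continuous_mulr; apply: continuous_kop.
  (* The form of [P] yields [c * k / 2] times [|w|^2]. Half of it is kept; the other half absorbs
     the linear term [<Lb, w>] by completing a square, at the cost [|Lb|^2 / (c * k)]. *)
  apply: (@convex_coercive_critical R T J DJ (c * k / 4)
            (dot Lb Lb / (c * k) - dot b r)).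
  - by rewrite !mulr_gt0// invr_gt0.
  - move=> w; rewrite /J.
    have ck0 : 0 < c * k by exact: mulr_gt0.
    have energyge : dot b r + dot Lb w <= energy (s w).
      rewrite /energy; have := Bpsd (s w).
      have : 0 <= \sum_x sqgrad (s w) x ^+ 2 by apply: sumr_ge0 => x _; exact: sqr_ge0.
      have -> : dot b (s w) = dot b r + dot Lb w.
        rewrite (dot_kop_sym _ _ Lsym) /dot -big_split.
        by apply: eq_bigr => x _; rewrite /s mulrDr.
      lra.
    have := dot_ge0 (fun x => (c * k / 2) * w x + 1 * Lb x).
    rewrite dotDl !dotDr (dotC w Lb) => sq.
    have := ler_wpM2l (ltW c0) (PP w).
    suff : 0 <= c * k / 4 * dot w w + dot Lb w + dot Lb Lb / (c * k) by lra.
    rewrite -(pmulr_rge0 _ ck0).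
    suff -> : c * k * (c * k / 4 * dot w w + dot Lb w + dot Lb Lb / (c * k)) =
       c * k / 2 * (c * k / 2 * dot w w + 1 * dot Lb w) +
       1 * (c * k / 2 * dot Lb w + 1 * dot Lb Lb) by [].
    by field; rewrite !gt_eqF.
  - apply: continuous_addr.
      apply: continuous_mulr => //; apply: continuous_mulr => //.
      by apply: continuous_dot => // x; apply: continuous_kop.
    rewrite /energy; apply: continuous_addr; last by apply: continuous_dot.
    apply: continuous_addr; apply: continuous_mulr => //.
      by apply: continuous_sumr => x; exact: continuous_mulr.
    by apply: continuous_dot => // x; apply: continuous_kop.
  - move=> x; apply: continuous_addr.
      by apply: continuous_mulr => //; exact: continuous_kop.
    apply: continuous_kop => y; apply: continuous_addr => //.
    apply: continuous_addr; last exact: continuous_kop.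
    rewrite /plaplace; apply: continuous_oppr.
    by do ?apply: continuous_addr; apply: continuous_kop => z;
       apply: continuous_mulr => //; apply: continuous_kop.
  - move=> w u; rewrite /J.
    have := quad_convex u w Psym Ppsd.
    have := energy_convex (s w) (s u).
    have -> : dot (potential (s w)) (fun x => s u x - s w x)
        = dot (kop L (potential (s w))) (fun x => u x - w x).
      rewrite (dot_kop_sym _ _ Lsym); apply: eq_dot => // x.
      by rewrite kopB /s; ring.
    have -> : dot (DJ w) (fun x => u x - w x) = c * dot (kop P w) (fun x => u x - w x)
        + dot (kop L (potential (s w))) (fun x => u x - w x).
      by rewrite /DJ /dot mulr_sumr -big_split; apply: eq_bigr => x _ /=; ring.
    move=> h1 h2; have := ler_wpM2l (ltW c0) h2; lra.
(* Summing [DJ w = 0] leaves only the rank-one part of [P], so [w] has zero sum and [P w = - L w];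
   the critical point equation then reads [c L w = L (potential (s w))] with [L w = s w - r]. *)
have w0 : \sum_x w x = 0.
  have [x0 _|T0] := pickP (@predT T); last by rewrite big_pred0.
  have n0 : 0 < #|T|%:R :> R by rewrite ltr0n; apply/card_gt0P; exists x0.
  have : \sum_x DJ w x = 0 by rewrite big1.
  rewrite /DJ big_split /= Lsum0 addr0 -mulr_sumr.
  rewrite (eq_bigr _ (fun x _ => opP w x)).
  rewrite big_split /= sumrN Lsum0 oppr0 add0r sumr_const -mulr_natr => /eqP.
  by rewrite !mulf_eq0 (gt_eqF c0) (gt_eqF g0) (gt_eqF n0) orbF => /eqP.
exists (s w) => x; have := Dw x.
rewrite /DJ opP w0 /s; lra.
Qed.
End PLaplace.

(** * Discrete Fourier modes and their orthogonality *)

Section Fourier.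
Local Open Scope complex_scope.
Variables (R : realType) (K : nat).
Local Notation N := (NN K).
Local Notation T := ('I_N * 'I_N * 'I_N)%type.

Lemma expiD (s t : R) : expi (s + t) = expi s * expi t.
Proof.
rewrite /expi cosD sinD; apply/eqP; rewrite eq_complex /=.
by rewrite eqxx/= [X in _ == X]addrC eqxx.
Qed.

Lemma expi0 : expi 0 = 1 :> R[i].
Proof. by rewrite /expi cos0 sin0. Qed.

Lemma expiN (t : R) : expi (- t) = conjc (expi t).
Proof. by rewrite /expi cosN sinN. Qed.

Lemma expi_nat (n : nat) (t : R) : expi (n%:R * t) = expi t ^+ n.
Proof.
elim: n => [|n ih]; first by rewrite mul0r expi0.
by rewrite -natr1 mulrDl mul1r expiD ih exprSr.
Qed.

Lemma expi_2pi : expi (2 * pi) = 1 :> R[i].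
Proof.
rewrite /expi mulr_natl -[pi *+ 2]add0r cosD2pi sinD2pi.
by rewrite cos0 sin0.
Qed.

Lemma expi_neq1 (t : R) : 0 < t < 2 * pi -> expi t != 1.
Proof.
move=> /andP[t0 t2]; rewrite /expi eq_complex /=; apply/nandP; left.
have s0 : 0 < sin (t / 2) by apply: sin_gt0_pi; apply/andP; split; lra.
have -> : t = t / 2 *+ 2 by rewrite mulr2n; lra.
rewrite cos_mulr2n; have := cos2Dsin2 (t / 2) => h; apply/negP => /eqP h2.
nra.
Qed.

Lemma NN_gt0 : 0 < N%:R :> R.
Proof. by rewrite ltr0n /NN addn1. Qed.

Lemma hhN : hh R K * N%:R = 1.
Proof. by rewrite /hh div1r mulVf// gt_eqF// NN_gt0. Qed.

(** A geometric sum over the powers of an N-th root of unity [z], with [z != 1] because [0 < d < N];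
    negative [d] follows by conjugation. *)
Lemma sum_expi (d : int) : d != 0 -> (`|d| < N)%N ->
  \sum_(q < N) expi (2 * pi * (d%:~R * (q%:R * hh R K))) = 0.
Proof.
wlog d0 : d / 0 < d => [hw dn0 dN|].
  have [dp|dneg] := ltrP 0 d; first exact: hw.
  have := hw (- d); rewrite oppr_gt0 lt_neqAle dn0 dneg oppr_eq0 abszN.
  move=> /(_ isT dn0 dN) /(congr1 (@conjc R)).
  rewrite conjc0 (raddf_sum (@conjc R)) => h; rewrite -[RHS]h.
  apply: eq_bigr => q _; apply: etrans (expiN _); congr expi.
  by rewrite rmorphN /=; ring.
move=> _ dN; pose z : R[i] := expi (2 * pi * (d%:~R * hh R K)).
have zq (q : nat) : expi (2 * pi * (d%:~R * (q%:R * hh R K))) = z ^+ q.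
  by rewrite /z -expi_nat; congr expi; ring.
under eq_bigr do rewrite zq.
have [n dE] : exists n : nat, d = n%:Z by exists `|d|%N; lia.
have zN : z ^+ N = 1.
  rewrite -zq [N%:R * _]mulrC hhN mulr1 dE mulrC -pmulrn expi_nat.
  by rewrite expi_2pi expr1n.
have z1 : z != 1.
  apply: expi_neq1; have h0 : 0 < hh R K by rewrite /hh divr_gt0// NN_gt0.
  have dh : d%:~R * hh R K < 1.
    rewrite -[ltRHS]hhN mulrC ltr_pM2l// dE -pmulrn ltr_nat; lia.
  have dp : 0 < d%:~R * hh R K by rewrite mulr_gt0// ltr0z.
  have pi0 := pi_gt0 R; apply/andP; split; nra.
apply/eqP; have := subrX1 z N; rewrite zN subrr => /esym/eqP.
by rewrite mulf_eq0 subr_eq0 (negPf z1).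
Qed.

Definition wave (l i : 'I_N) : R[i] := expi (2 * pi * ((freq l)%:~R * Defs.coord R i)).

Lemma modeE (l m n i j k : 'I_N) :
  mode R l m n i j k = wave l i * wave m j * wave n k.
Proof. by rewrite /mode /wave -!expiD !mulrDr. Qed.

Lemma wave_orth (i j : 'I_N) :
  \sum_l wave l i * conjc (wave l j) = if i == j then N%:R else 0.
Proof.
(* The shift of the frequencies by [K] factors out as a phase, leaving [sum_expi] with
   [d = i - j]. *)
have -> : \sum_l wave l i * conjc (wave l j) =
  expi (2 * pi * (- K%:R * (Defs.coord R i - Defs.coord R j))) *
  \sum_(l < N) expi (2 * pi * ((i%:Z - j%:Z)%:~R * (l%:R * hh R K))).
  rewrite mulr_sumr; apply: eq_bigr => l _.
  rewrite /wave -expiN -!expiD; congr expi.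
  by rewrite /Defs.coord /freq !rmorphB /= -!pmulrn; ring.
have [->|ij] := eqVneq i j.
  rewrite subrr mulr0 mulr0 expi0 mul1r subrr.
  under eq_bigr do rewrite mul0r mulr0 expi0.
  by rewrite sumr_const card_ord.
rewrite sum_expi ?mulr0//.
  by rewrite subr_eq0; apply: contra ij => /eqP [] /val_inj ->.
by have := ltn_ord i; have := ltn_ord j; lia.
Qed.

Lemma wave_sum (l : 'I_N) : freq l != 0 -> \sum_i wave l i = 0.
Proof.
by move=> l0; rewrite sum_expi//; have := ltn_ord l; rewrite /freq /NN; lia.
Qed.

Lemma sum_triple (V : nmodType) (F : 'I_N -> 'I_N -> 'I_N -> V) :
  \sum_i \sum_j \sum_k F i j k = \sum_(x : T) F x.1.1 x.1.2 x.2.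
Proof. by rewrite pair_big /= pair_big. Qed.

Lemma sum_triple_prod (f g h : 'I_N -> R[i]) :
  \sum_(x : T) f x.1.1 * g x.1.2 * h x.2
  = (\sum_i f i) * (\sum_i g i) * (\sum_i h i).
Proof.
rewrite -(sum_triple (fun i j k => f i * g j * h k)).
rewrite !mulr_suml; apply: eq_bigr => i _.
rewrite [f i * _]mulr_sumr mulr_suml; apply: eq_bigr => j _.
by rewrite mulr_sumr.
Qed.

Definition mode3 (l x : T) : R[i] := mode R l.1.1 l.1.2 l.2 x.1.1 x.1.2 x.2.

Lemma mode3_orth (x y : T) :
  \sum_l mode3 l x * conjc (mode3 l y) = if x == y then (N ^ 3)%:R else 0.
Proof.
pose F a b := (fun l => wave l a * conjc (wave l b)).
rewrite (eq_bigr (fun l : T => F x.1.1 y.1.1 l.1.1 * F x.1.2 y.1.2 l.1.2 * F x.2 y.2 l.2)).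
  rewrite sum_triple_prod !wave_orth.
  case: x y => [[x1 x2] x3] [[y1 y2] y3]; rewrite /= !xpair_eqE.
  by do 3 case: eqP => _ /=; rewrite ?(mul0r, mulr0)// natrX; ring.
by move=> l _; rewrite /mode3 !modeE !rmorphM /F; ring.
Qed.

(** * Spectral operators as real kernels *)

Lemma Re_mulJ (z w : R[i]) : complex.Re (z * conjc w) =
  complex.Re z * complex.Re w + complex.Im z * complex.Im w.
Proof. by case: z w => [a b] [c d] /=; ring. Qed.

Lemma Im_mulJ (z w : R[i]) : complex.Im (z * conjc w) =
  complex.Im z * complex.Re w - complex.Re z * complex.Im w.
Proof. by case: z w => [a b] [c d] /=; ring. Qed.

Lemma Re_sum (I : finType) (F : I -> R[i]) :
  complex.Re (\sum_i F i) = \sum_i complex.Re (F i).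
Proof. by apply: (big_morph (@complex.Re R)) => // -[a b] [c d]. Qed.

(** Passes to one finite index type, on which the abstract results above apply. *)
Definition flat (f : grid R K) : T -> R := fun x => f x.1.1 x.1.2 x.2.

(* [kre s] and [kim s] are the real-space kernels of the Fourier multipliers [s]
   and ['i * s]. *)
Definition kre (s : T -> R) (x y : T) : R :=
  hh R K ^+ 3 * \sum_l s l * complex.Re (mode3 l x * conjc (mode3 l y)).

Definition kim (s : T -> R) (x y : T) : R :=
  hh R K ^+ 3 * \sum_l s l * complex.Im (mode3 l y * conjc (mode3 l x)).

Lemma kre_sym s x y : kre s x y = kre s y x.
Proof.
by congr (_ * _); apply: eq_bigr => l _; rewrite !Re_mulJ; ring.
Qed.

Lemma kim_skew s x y : kim s x y = - kim s y x.
Proof.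
rewrite /kim -mulrN -sumrN; congr (_ * _); apply: eq_bigr => l _.
by rewrite !Im_mulJ; ring.
Qed.

(** Insert [fhat] and exchange the sums over frequencies and grid points; [f] being real, the real
    part falls on the kernel alone. *)
Lemma specopE sym (f : grid R K) i j k : specop sym f i j k =
  kop (fun x y => hh R K ^+ 3 * \sum_(l : T) complex.Re (sym (freq l.1.1) (freq l.1.2) (freq l.2)
        * (mode3 l x * conjc (mode3 l y)))) (flat f) (i, j, k).
Proof.
rewrite /specop sum_triple Re_sum /kop.
under [RHS]eq_bigr do rewrite mulr_sumr mulr_suml.
rewrite [RHS]exchange_big; apply: eq_bigr => l _ /=.
rewrite /fhat sum_triple.
rewrite (_ : _ * _ * _ = \sum_(y : T) (hh R K ^+ 3 * flat f y)%:C *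
  (sym (freq l.1.1) (freq l.1.2) (freq l.2) * (mode3 l (i, j, k) * conjc (mode3 l y)))).
  rewrite Re_sum; apply: eq_bigr => y _.
  case: (sym _ _ _ * _) => u v /=; ring.
rewrite mulr_sumr mulr_sumr mulr_suml; apply: eq_bigr => y _.
rewrite -[Num.conj _]/(conjc _) rmorphM /flat /mode3 /=; ring.
Qed.

Definition sdx (l : T) : R := 2 * pi * (freq l.1.1)%:~R.
Definition sdy (l : T) : R := 2 * pi * (freq l.1.2)%:~R.
Definition sdz (l : T) : R := 2 * pi * (freq l.2)%:~R.
Definition slap (l : T) : R :=
  - 4 * pi ^+ 2 * ((freq l.1.1)%:~R ^+ 2 + (freq l.1.2)%:~R ^+ 2
                   + (freq l.2)%:~R ^+ 2).

Lemma lapNE f i j k : lapN f i j k = kop (kre slap) (flat f) (i, j, k).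
Proof.
rewrite /lapN specopE; apply: eq_bigr => y _; congr (_ * _ * _).
by apply: eq_bigr => l _; rewrite /slap; case: (mode3 _ _ * _) => u v /=; ring.
Qed.

(** The real part of ['i * z] is minus the imaginary part of [z]; the exchange of [x] and [y] in
    [kim] absorbs this sign. *)
Lemma specop_kim (s : T -> R) sym f i j k :
  (forall l : T, sym (freq l.1.1) (freq l.1.2) (freq l.2) = (s l)%:C * 'i) ->
  specop sym f i j k = kop (kim s) (flat f) (i, j, k).
Proof.
move=> symE; rewrite specopE; apply: eq_bigr => y _; congr (_ * _ * _).
apply: eq_bigr => l _; rewrite symE !Im_mulJ.
by case: (mode3 l y) (mode3 _ _) => u v [u' v'] /=; ring.
Qed.

(** Diagonalisation: up to a power of [hh], the bracket is the squared modulus of a Fourier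
    coefficient of [w]. *)
Lemma kre_quad s (w : T -> R) : dot (kop (kre s) w) w = hh R K ^+ 3 *
  \sum_l s l * ((\sum_x w x * complex.Re (mode3 l x)) ^+ 2
                + (\sum_x w x * complex.Im (mode3 l x)) ^+ 2).
Proof.
rewrite dot_kopE mulr_sumr.
transitivity (\sum_x \sum_y \sum_l hh R K ^+ 3 * s l * w x * w y *
    (complex.Re (mode3 l x) * complex.Re (mode3 l y)
    + complex.Im (mode3 l x) * complex.Im (mode3 l y))).
  apply: eq_bigr => x _; apply: eq_bigr => y _.
  rewrite /kre mulr_sumr !mulr_suml; apply: eq_bigr => l _.
  by rewrite Re_mulJ; ring.
under eq_bigr do rewrite exchange_big /=.
rewrite exchange_big; apply: eq_bigr => l _ /=.
rewrite !expr2 !big_distrlr /= -big_split /= !mulr_sumr.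
apply: eq_bigr => x _; rewrite -big_split !mulr_sumr.
by apply: eq_bigr => y _ /=; ring.
Qed.

(** Fourier inversion; with [kre_quad] it gives Parseval's identity. *)
Lemma kre1 (w : T -> R) x : kop (kre (fun=> 1)) w x = w x.
Proof.
rewrite /kop (bigD1 x)//= big1 ?addr0 => [|y yx]; rewrite /kre.
  under eq_bigr do rewrite mul1r.
  rewrite -Re_sum mode3_orth eqxx -(rmorph_nat (real_complex R)) /=.
  by rewrite natrX -exprMn hhN expr1n mul1r.
under eq_bigr do rewrite mul1r.
by rewrite -Re_sum mode3_orth eq_sym (negPf yx) /= mulr0 mul0r.
Qed.

(** * Spectrum of the discrete Laplacian *)

Local Notation L := (kre slap).
Local Notation h := (hh R K).

Lemma slap_le (l : T) : slap l <= 0.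
Proof.
have : 0 <= pi ^+ 2 * ((freq l.1.1)%:~R ^+ 2 + (freq l.1.2)%:~R ^+ 2
                   + (freq l.2)%:~R ^+ 2) :> R.
  by rewrite mulr_ge0 ?addr_ge0 ?sqr_ge0.
rewrite /slap; lra.
Qed.

Lemma slap_gap (l : T) : [|| freq l.1.1 != 0, freq l.1.2 != 0 | freq l.2 != 0] ->
  slap l <= - 4 * pi ^+ 2.
Proof.
move=> l0; have : 1 <= freq l.1.1 ^+ 2 + freq l.1.2 ^+ 2 + freq l.2 ^+ 2 by nia.
rewrite -(ler1z R) !rmorphD !rmorphXn /= => h1.
have := ler_wpM2l (sqr_ge0 (pi : R)) h1.
rewrite /slap; lra.
Qed.

Lemma K_lt_NN : (K < N)%N.
Proof. by rewrite /NN; lia. Qed.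

(** Frequencies are stored with offset [K], so the constant mode has index [K] in each direction. *)
Definition freq0 : T := let q := Ordinal K_lt_NN in (q, q, q).

Lemma freq_neq0 (l : T) : l != freq0 ->
  [|| freq l.1.1 != 0, freq l.1.2 != 0 | freq l.2 != 0].
Proof.
have freq_eq0 (a : 'I_N) : freq a == 0 -> a = Ordinal K_lt_NN.
  by rewrite /freq => a0; apply: val_inj => /=; lia.
apply: contraNT; rewrite !negb_or !negbK => /and3P[l1 l2 l3].
by case: l l1 l2 l3 => [[a b] c] /= /freq_eq0 -> /freq_eq0 -> /freq_eq0 ->.
Qed.

Lemma mode3_freq0 x : mode3 freq0 x = 1.
Proof.
by rewrite /mode3 modeE /wave /freq /= subrr !mul0r !mulr0 !expi0 !mul1r.
Qed.

Lemma slap_freq0 : slap freq0 = 0.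
Proof. by rewrite /slap /freq0 /freq /= subrr expr0n /= !addr0 mulr0. Qed.

Lemma h_gt0 : 0 < h.
Proof. by rewrite /hh divr_gt0// NN_gt0. Qed.

(** In Fourier space every mode but the constant one has symbol at most [- 4 * pi ^+ 2]; the
    constant mode contributes exactly the squared sum of [w]. *)
Lemma lap_coercive w : 4 * pi ^+ 2 * dot w w <=
  - dot (kop L w) w + 4 * pi ^+ 2 * h ^+ 3 * (\sum_x w x) ^+ 2.
Proof.
have {1}-> : dot w w = dot (kop (kre (fun=> 1)) w) w.
  by apply: eq_dot => // x; rewrite kre1.
rewrite !kre_quad.
pose q l := (\sum_x w x * complex.Re (mode3 l x)) ^+ 2
            + (\sum_x w x * complex.Im (mode3 l x)) ^+ 2.
have q_ge0 l : 0 <= q l by rewrite addr_ge0// sqr_ge0.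
have q0 : q freq0 = (\sum_x w x) ^+ 2.
  rewrite /q [X in _ + X ^+ 2]big1 => [|x _]; last by rewrite mode3_freq0 mulr0.
  by rewrite expr0n addr0; under eq_bigr do rewrite mode3_freq0 mulr1.
suff : 4 * pi ^+ 2 * (\sum_l 1 * q l) + \sum_l slap l * q l
       <= 4 * pi ^+ 2 * (\sum_x w x) ^+ 2.
  move=> H; have := ler_wpM2l (exprn_ge0 3 (ltW h_gt0)) H; rewrite /q; lra.
rewrite mulr_sumr -big_split /= (bigD1 freq0)//= slap_freq0 q0 mul0r addr0 mul1r.
rewrite gerDl; apply: sumr_le0 => l /freq_neq0/slap_gap gap.
by have := ler_wpM2r (q_ge0 l) gap; lra.
Qed.

Lemma lap_nsd w : dot (kop L w) w <= 0.
Proof.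
rewrite kre_quad pmulr_rle0 ?exprn_gt0 ?h_gt0//; apply: sumr_le0 => l _.
by rewrite mulr_le0_ge0 ?slap_le// addr_ge0// sqr_ge0.
Qed.

(** The constant mode has symbol zero, and every other mode sums to zero over the grid. *)
Lemma lap_sum0 w : \sum_x kop L w x = 0.
Proof.
rewrite exchange_big big1 // => y _; rewrite -mulr_suml.
rewrite [X in X * _](_ : _ = 0) ?mul0r// -mulr_sumr exchange_big big1 ?mulr0//.
move=> l _; rewrite -mulr_sumr.
have [->|l0] := eqVneq l freq0; first by rewrite slap_freq0 mul0r.
rewrite -Re_sum -mulr_suml.
have -> : \sum_x mode3 l x = 0.
  rewrite (eq_bigr (fun x : T => wave l.1.1 x.1.1 * wave l.1.2 x.1.2 * wave l.2 x.2)).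
    rewrite sum_triple_prod.
    by case/or3P: (freq_neq0 l0) => f0; rewrite (wave_sum f0) ?(mul0r, mulr0).
  by move=> x _; rewrite -modeE.
by rewrite mul0r mulr0.
Qed.

(** * The two schemes as instances of the abstract equation *)

Lemma flat_curry (p : T -> R) : flat (fun i j k => p (i, j, k)) = p.
Proof. by apply/funext => -[[i j] k]. Qed.

(** The operator [a + b L + L^2], general enough for the implicit linear part of both potentials. *)
Definition kquad (a b : R) (x y : T) : R :=
  a * kre (fun=> 1) x y + b * L x y + \sum_z L x z * L z y.

Lemma kquad_sym a b x y : kquad a b x y = kquad a b y x.
Proof.
rewrite /kquad !(kre_sym _ x y); congr (_ + _); apply: eq_bigr => z _.
by rewrite (kre_sym _ x z) (kre_sym _ z y) mulrC.
Qed.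

Lemma kop_kquad a b w x :
  kop (kquad a b) w x = a * w x + b * kop L w x + kop L (kop L w) x.
Proof.
rewrite -kop_comp -{1}(kre1 w) /kop !mulr_sumr -!big_split.
by apply: eq_bigr => y _ /=; rewrite /kquad; ring.
Qed.

Lemma dot_kquad a b w : dot (kop (kquad a b) w) w =
  a * dot w w + b * dot (kop L w) w + dot (kop L w) (kop L w).
Proof.
rewrite -(dot_kop_sym (kop L w) w (@kre_sym _)).
rewrite /dot !mulr_sumr -!big_split; apply: eq_bigr => x _ /=.
by rewrite kop_kquad; ring.
Qed.

Local Notation pot a b be :=
  (potential (kim sdx) (kim sdy) (kim sdz) (kquad a b) be).

Lemma DxE (f : grid R K) i j k : Dx f i j k = kop (kim sdx) (flat f) (i, j, k).
Proof. exact: specop_kim. Qed.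

Lemma DyE (f : grid R K) i j k : Dy f i j k = kop (kim sdy) (flat f) (i, j, k).
Proof. exact: specop_kim. Qed.

Lemma DzE (f : grid R K) i j k : Dz f i j k = kop (kim sdz) (flat f) (i, j, k).
Proof. exact: specop_kim. Qed.

Lemma pLapE (f : grid R K) i j k : pLap f i j k =
  plaplace (kim sdx) (kim sdy) (kim sdz) (flat f) (i, j, k).
Proof.
rewrite /pLap /divN DxE DyE DzE /plaplace.
by congr (_ + _ + _); apply: kop_ext => -[[i' j'] k']; rewrite /flat /sqgrad /= !(DxE, DyE, DzE).
Qed.

Lemma scheme_exists_unique mu (dt eps A a b : R) (be : T -> R) (phim phi0 : grid R K) :
  0 < dt -> (forall w, 0 <= dot (kop (kquad a b) w) w) ->
  (forall phi x, flat (mu dt eps A phim phi0 phi) x = pot a b be (flat phi) x) ->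
  exists! phi, scheme mu dt eps A phim phi0 phi.
Proof.
move=> dt0 psd muE.
pose r x := (4 * flat phi0 x - flat phim x) / 3.
pose c := 3 / (2 * dt).
have c0 : 0 < c by rewrite divr_gt0// mulr_gt0.
have schE phi : scheme mu dt eps A phim phi0 phi <->
    forall x, c * (flat phi x - r x) = kop L (pot a b be (flat phi)) x.
  have lhsE x : (3 / 2 * flat phi x - 2 * flat phi0 x + 1 / 2 * flat phim x) / dt
                = c * (flat phi x - r x).
    by rewrite /c /r; field; rewrite gt_eqF.
  split=> [sch [[i j] k]|eqn i j k].
    rewrite -lhsE (sch i j k) lapNE; apply: kop_ext => x; exact: muE.
  rewrite (lhsE (i, j, k)) eqn lapNE; apply: kop_ext => x; exact/esym/muE.
have pi0 : 0 < 4 * pi ^+ 2 :> R by rewrite mulr_gt0// exprn_gt0// pi_gt0.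
(* The constants [k = 4 pi^2] and [g = 4 pi^2 h^3] are those of [lap_coercive]. *)
have [p pE] := flow_exists be r (kim_skew sdx) (kim_skew sdy) (kim_skew sdz)
  (kquad_sym a b) psd (kre_sym slap) lap_sum0 c0 pi0
  (mulr_gt0 pi0 (exprn_gt0 3 h_gt0)) lap_coercive.
exists (fun i j k => p (i, j, k)); split; first by apply/schE; rewrite flat_curry.
move=> q /schE qE; apply/funext => i; apply/funext => j; apply/funext => k.
have pq := flow_unique (kim_skew sdx) (kim_skew sdy) (kim_skew sdz) (kquad_sym a b) psd
  (kre_sym slap) lap_sum0 c0 pi0 lap_coercive pE qE.
exact: pq (i, j, k).
Qed.

Lemma flat_lapN (f : grid R K) : flat (lapN f) = kop L (flat f).
Proof. by apply/funext => -[[i j] k]; rewrite /flat /= lapNE. Qed.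

(** The artificial diffusion is split: its [phi] part enters the coefficient of [L], its [phi0] part
    the explicit term. *)
Lemma mu1E (dt eps A : R) (phim phi0 phi : grid R K) x :
  flat (mu1 dt eps A phim phi0 phi) x =
  pot (1 - eps) (- (A * dt))
    (fun x => 2 * kop L (flat (fun i j k => 2 * phi0 i j k - phim i j k)) x
              + A * dt * kop L (flat phi0) x) (flat phi) x.
Proof.
case: x => [[i j] k]; rewrite {1}/flat /mu1 /potential kop_kquad /= pLapE !lapNE flat_lapN.
rewrite [X in A * dt * X](kopB L (flat phi) (flat phi0)) /flat /=; ring.
Qed.

(** The coefficient [2 - A * dt] arises from [(1 + L)^2 = 1 + 2 L + L^2] and the artificial
    diffusion. *)
Lemma mu2E (dt eps A : R) (phim phi0 phi : grid R K) x :
  flat (mu2 dt eps A phim phi0 phi) x =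
  pot 1 (2 - A * dt)
    (fun x => - eps * (2 * flat phi0 x - flat phim x) + A * dt * kop L (flat phi0) x)
    (flat phi) x.
Proof.
case: x => [[i j] k].
rewrite {1}/flat /mu2 /potential kop_kquad /= pLapE /oneplap !lapNE.
rewrite [X in A * dt * X](kopB L (flat phi) (flat phi0)).
have -> : flat (fun i j k => phi i j k + lapN phi i j k)
          = (fun x => 1 * flat phi x + 1 * kop L (flat phi) x).
  by rewrite -flat_lapN; apply/funext => x; rewrite !mul1r.
rewrite kopD /flat /=; ring.
Qed.

(** * Mass conservation *)

Lemma meanE (f : grid R K) : mean f = h ^+ 3 * \sum_x flat f x.
Proof.
rewrite /mean /ip sum_triple; congr (_ * _).
by apply: eq_bigr => x _; rewrite mulr1.
Qed.

(** The right-hand side sums to zero, so the means satisfy the recursion with weights 3/2, -2, 1/2,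
    and these weights add up to zero. *)
Lemma scheme_mean mu (dt eps A : R) (phim phi0 phi : grid R K) :
  0 < dt -> scheme mu dt eps A phim phi0 phi -> mean phi0 = mean phim ->
  mean phi = mean phi0.
Proof.
move=> dt0 sch; have : \sum_x (3 / 2 * flat phi x - 2 * flat phi0 x
                               + 1 / 2 * flat phim x) / dt = 0.
  rewrite -[RHS](lap_sum0 (flat (mu dt eps A phim phi0 phi))).
  by apply: eq_bigr => -[[i j] k] _; rewrite -lapNE -sch.
rewrite -mulr_suml big_split /= sumrB -!mulr_sumr => /eqP.
rewrite mulf_eq0 invr_eq0 (gt_eqF dt0) orbF => /eqP e.
rewrite !meanE => m; have := congr1 ( *%R (h ^+ 3)) e; lra.
Qed.

Lemma sequence_mean mu (dt eps A : R) (seqs : nat -> grid R K) : 0 < dt ->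
  (forall n, scheme mu dt eps A (seqs n) (seqs n.+1) (seqs n.+2)) ->
  mean (seqs 1%N) = mean (seqs 0%N) ->
  forall n, mean (seqs n.+1) = mean (seqs 1%N).
Proof.
move=> dt0 sch m10 n.
(* The induction carries two consecutive means, since each step looks back two levels. *)
have [//] : mean (seqs n.+1) = mean (seqs 1%N) /\ mean (seqs n) = mean (seqs 1%N).
elim: n => [|n [ih1 ih0]]; first by rewrite m10.
by rewrite ih1 (scheme_mean dt0 (sch n)) ih1.
Qed.

End Fourier.

(* Sequences (phi^k)_{k >= -1} are encoded as seqs : nat -> grid with
   seqs n = phi^{n-1}. *)
Theorem theorem3p1 (R : realType) (K : nat) (dt eps A : R) :
  0 < dt -> 0 < eps -> eps < 1 -> 0 <= A ->
  (forall phi0 phim : grid R K, mean phi0 = mean phim ->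
     (exists! phi1 : grid R K, scheme (@mu1 R K) dt eps A phim phi0 phi1) /\
     (exists! phi1 : grid R K, scheme (@mu2 R K) dt eps A phim phi0 phi1)) /\
  (forall seqs : nat -> grid R K,
     (forall n, scheme (@mu1 R K) dt eps A (seqs n) (seqs n.+1) (seqs n.+2)) ->
     mean (seqs 1%N) = mean (seqs 0%N) ->
     forall n, mean (seqs n.+1) = mean (seqs 1%N)) /\
  (forall seqs : nat -> grid R K,
     (forall n, scheme (@mu2 R K) dt eps A (seqs n) (seqs n.+1) (seqs n.+2)) ->
     mean (seqs 1%N) = mean (seqs 0%N) ->
     forall n, mean (seqs n.+1) = mean (seqs 1%N)).
Proof.
move=> dt0 _ eps1 A0.
have Adt (w : 'I_(NN K) * 'I_(NN K) * 'I_(NN K) -> R) :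
    A * dt * dot (kop (kre (@slap R K)) w) w <= 0.
  by rewrite mulr_ge0_le0 ?lap_nsd// mulr_ge0// ltW.
split; last by split => seqs; exact: sequence_mean.
move=> phi0 phim _; split.
  apply: (scheme_exists_unique dt0 _ (mu1E dt eps A phim phi0)) => w.
  (* All three terms are nonnegative, the middle one because [L] is negative semidefinite and its
     coefficient is [- (A * dt)]. *)
  rewrite dot_kquad.
  have : 0 <= (1 - eps) * dot w w by rewrite mulr_ge0 ?dot_ge0 ?subr_ge0// ltW.
  have := dot_ge0 (kop (kre (@slap R K)) w); have := Adt w; lra.
apply: (scheme_exists_unique dt0 _ (mu2E dt eps A phim phi0)) => w.
(* The form equals [|w + L w|^2 - A dt <L w, w>], so the indefinite term [2 <L w, w>] is hidden in a
   square. *)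
have := dot_ge0 (fun x => 1 * w x + 1 * kop (kre (@slap R K)) w x).
rewrite dot_kquad dotDl !dotDr (dotC w (kop _ w)); have := Adt w; lra.
Qed.
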